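(* Let $S,\mathcal Z,h^{\mathcal Z},R$, $g_R=R^*h^{\mathcal Z}$, $g^S$, $\nabla^S$, $\nabla^{\mathcal Z}$ and the response derivative tensor $\mathcal T=\nabla R$ be as in the context. For all vector fields $X,Y,Z$ on $S$, $$(\nabla_Xg_R)(Y,Z)=h^{\mathcal Z}\bigl(\mathcal T(X)Y,RZ\bigr)+h^{\mathcal Z}\bigl(RY,\mathcal T(X)Z\bigr),$$ where $\nabla g_R$ is the covariant derivative of $g_R$ with respect to $\nabla^S$.
   Context: $S$ is a smooth finite-dimensional manifold parameterizing a smooth family $\{g_p\}_{p\in S}$ of normalized Einstein metrics on a fixed smooth manifold $M$. The family comes with the following given data, which is all that the statement uses: a smooth real vector bundle $\mathcal Z\to S$ of finite rank, a smooth positive-definite fibre metric $h^{\mathcal Z}$ on $\mathcal Z$, and a smooth vector bundle morphism $R:TS\to\mathcal Z$ over the identity of $S$. The response metric is $g_R(X,Y)=h^{\mathcal Z}(RX,RY)$. Fix an auxiliary Riemannian metric $g^S$ on $S$ with Levi-Civita connection $\nabla^S$, and a metric connection $\nabla^{\mathcal Z}$ on $(\mathcal Z,h^{\mathcal Z})$ (i.e. $\nabla^{\mathcal Z}h^{\mathcal Z}=0$). These induce the standard connection $\nabla$ on $\operatorname{Hom}(TS,\mathcal Z)$, and the response derivative tensor is $\mathcal T:=\nabla R$, i.e. $\mathcal T(X)Y=(\nabla_XR)(Y)=\nabla^{\mathcal Z}_X(RY)-R(\nabla^S_XY)$. *)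

(* Defs.v *)
From HB Require Import structures.
From mathcomp Require Import all_boot all_order all_algebra.
From mathcomp Require Import all_classical all_reals all_analysis.
Set Implicit Arguments. Unset Strict Implicit. Unset Printing Implicit Defensive.
Import Order.TTheory GRing.Theory Num.Theory numFieldNormedType.Exports.
Local Open Scope classical_set_scope.
Local Open Scope ring_scope.

Section Ck.
Context {R : realType}.

(* [Ck k U f], for U open: f is k times continuously differentiable on U.  The
   sources V used below are the finite-dimensional spaces 'rV[R]_n, where
   continuity of x |-> 'd f x v for each fixed v is the same as continuity of
   the differential for the operator norm. *)
Fixpoint Ck (k : nat) {V W : normedModType R} (U : set V) (f : V -> W) : Prop :=
  if k is k'.+1 then
    (forall x, U x -> differentiable f x) /\
    (forall v, Ck k' U (fun x => 'd f x v))
  else forall x, U x -> {for x, continuous f}.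

Definition Cinfty {V W : normedModType R} (U : set V) (f : V -> W) : Prop :=
  forall k, Ck k U f.

Implicit Types V W : normedModType R.

Lemma near0_diff V W (h : V -> W) x : (\forall y \near x, h y = 0) ->
  differentiable h x /\ 'd h x = 0 :> (V -> W).
Proof.
move=> hx.
have h0 : h x = 0 by exact: (nbhs_singleton hx).
have key : h \o shift x = cst (h x) + (\0 : V -> W) +o_ 0 id.
  apply/eqaddoP => e e0.
  have : \forall y \near (0 : V), h (y + x) = 0.
    have c : (shift x : V -> V) y @[y --> (0 : V)] --> x.
      rewrite -[X in _ --> X]add0r; apply: cvgD; [exact: cvg_id|exact: cvg_cst].
    exact: c hx.
  apply: filterS => y hy.
  have -> : (h \o shift x - (cst (h x) + (\0 : V -> W))) y = 0.
    by change (h (y + x) - (h x + 0) = 0); rewrite hy h0 addr0 subrr.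
  by rewrite normr0 mulr_ge0// ltW.
have c0 : continuous (\0 : V -> W) by move=> z; apply: cvg_cst.
have d0 : 'd h x = \0 :> (V -> W) by exact: diff_unique c0 key.
split => //; apply/diff_locallyP; rewrite d0; split => //.
Qed.

Lemma near_diff V W (f g : V -> W) x : (\forall y \near x, f y = g y) ->
  differentiable f x -> differentiable g x /\ 'd g x = 'd f x :> (V -> W).
Proof.
move=> fg df.
have [dh h0] : differentiable (g - f) x /\ 'd (g - f) x = 0 :> (V -> W).
  apply: near0_diff; apply: filterS fg => y e.
  by rewrite /GRing.add/= /GRing.opp/= e subrr.
have -> : g = f + (g - f) by rewrite addrC subrK.
split; first exact: differentiableD.
rewrite diffD//; apply/funext => v.
by rewrite /= [X in _ + X](_ : _ = 0) ?addr0 // h0.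
Qed.

Lemma diff_chain V V' W (f : V -> V') (g : V' -> W) (h : V -> W) x y v :
  differentiable f x -> f x = y -> differentiable g y ->
  (\forall z \near x, g (f z) = h z) -> 'd h x v = 'd g y ('d f x v).
Proof.
move=> df <- dg e.
have [_ eh] := near_diff (f := g \o f) e (differentiable_comp df dg).
exact: etrans (congr1 (fun u : V -> W => u v) eh)
              (congr1 (fun u : V -> W => u v) (diff_comp df dg)).
Qed.

Lemma Ck_eq k V W (U : set V) (f g : V -> W) : open U ->
  (forall x, U x -> f x = g x) -> Ck k U f -> Ck k U g.
Proof.
move=> oU; elim: k f g => [|k IH] f g fg /=.
  move=> cf x Ux; change (g y @[y --> x] --> g x); rewrite -(fg x Ux).
  apply: cvg_trans (cf x Ux); apply: near_eq_cvg.
  by near=> y; apply: fg; near: y; exact: open_nbhs_nbhs.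
have nfg x : U x -> \forall y \near x, f y = g y.
  by move=> Ux; near=> y; apply: fg; near: y; exact: open_nbhs_nbhs.
move=> [df Cf]; split.
  by move=> x Ux; have [] := near_diff (nfg x Ux) (df x Ux).
move=> v; apply: IH (Cf v) => x Ux.
by have [_ ->] := near_diff (nfg x Ux) (df x Ux).
Unshelve. all: by end_near.
Qed.

Lemma CkS k V W (U : set V) (f : V -> W) : Ck k.+1 U f -> Ck k U f.
Proof.
elim: k f => [|k IH] f; first by move=> [df _] x Ux; exact: differentiable_continuous (df x Ux).
move=> [df Cf]; split => // v; exact: IH.
Qed.

Lemma Ck_sub k V W (U U' : set V) (f : V -> W) : U' `<=` U -> Ck k U f -> Ck k U' f.
Proof.
move=> s; elim: k f => [|k IH] f; first by move=> C x /s /C.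
by move=> [df Cf]; split; [move=> x /s; exact: df|move=> v; exact: IH (Cf v)].
Qed.

Lemma Ck_cst k V W (U : set V) (c : W) : open U -> Ck k U (fun=> c).
Proof.
move=> oU; elim: k c => [|k IH] c /=; first by move=> x _; exact: cvg_cst.
split=> [x _|v]; first exact: differentiable_cst.
by apply: (Ck_eq oU _ (IH 0)) => x _; rewrite (diff_cst c x).
Qed.

Lemma CkD k V W (U : set V) (f g : V -> W) : open U ->
  Ck k U f -> Ck k U g -> Ck k U (fun x => f x + g x).
Proof.
move=> oU; elim: k f g => [|k IH] f g /=.
  by move=> cf cg x Ux; apply: continuousD; [exact: cf|exact: cg].
move=> [df Cf] [dg Cg]; split=> [x Ux|v].
  by apply: differentiableD; [exact: df|exact: dg].
apply: (Ck_eq oU _ (IH _ _ (Cf v) (Cg v))) => x Ux.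
exact: esym (congr1 (fun h : V -> W => h v) (diffD (df x Ux) (dg x Ux))).
Qed.

Lemma Ck_sum k V W (U : set V) n (f : 'I_n -> V -> W) : open U ->
  (forall i, Ck k U (f i)) -> Ck k U (fun x => \sum_(i < n) f i x).
Proof.
move=> oU; elim: n f => [|n IH] f Cf.
  by apply: (Ck_eq oU _ (Ck_cst k (0 : W) oU)) => x _; rewrite big_ord0.
apply: (Ck_eq oU _ (CkD oU (IH _ (fun i => Cf (widen_ord (leqnSn n) i))) (Cf ord_max))).
by move=> x _; rewrite big_ord_recr.
Qed.

Lemma CkM k V (U : set V) (f g : V -> R^o) : open U ->
  Ck k U f -> Ck k U g -> Ck k U (fun x => f x * g x : R^o).
Proof.
move=> oU; elim: k f g => [|k IH] f g.
  by move=> cf cg x Ux; apply: (@continuousM R V f g); [exact: cf|exact: cg].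
move=> [df Cf] [dg Cg]; split=> [x Ux|v].
  by apply: differentiableM; [exact: df|exact: dg].
apply: (Ck_eq oU _ (CkD oU (IH _ _ (CkS (conj df Cf)) (Cg v))
  (IH _ _ (CkS (conj dg Cg)) (Cf v)))) => x Ux.
exact: esym (congr1 (fun h : V -> R => h v) (diffM (df x Ux) (dg x Ux))).
Qed.

Lemma coord_lin n (j : 'I_n) : linear (fun v : 'rV[R]_n => v 0 j : R^o).
Proof. by move=> a u v; rewrite !mxE. Qed.

Lemma diff_coord m n (f : 'rV[R]_m -> 'rV[R]_n) x j : differentiable f x ->
  differentiable (fun y => f y 0 j : R^o) x /\
  forall v, 'd (fun y => f y 0 j : R^o) x v = 'd f x v 0 j.
Proof.
move=> df.
pose cl : {linear 'rV[R]_n -> R^o} :=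
  HB.pack (fun v : 'rV[R]_n => v 0 j : R^o) (GRing.isLinear.Build _ _ _ _ _ (@coord_lin n j)).
have cc : continuous cl by exact: coord_continuous.
have dc : differentiable cl (f x) by exact: linear_differentiable.
split; first exact: (differentiable_comp df dc).
move=> v; rewrite [LHS](_ : _ = 'd (cl \o f) x v)//.
rewrite diff_comp//=.
exact: (congr1 (fun h : 'rV[R]_n -> R => h ('d f x v)) (diff_lin (f x) cc)).
Qed.

Lemma Ck_coord k m n (U : set 'rV[R]_m) (f : 'rV[R]_m -> 'rV[R]_n) j :
  open U -> Ck k U f -> Ck k U (fun x => f x 0 j : R^o).
Proof.
move=> oU; elim: k f => [|k IH] f.
  move=> cf x Ux.
  apply: (@continuous_comp _ _ _ f (fun v : 'rV[R]_n => v 0 j : R^o)); first exact: cf.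
  exact: coord_continuous.
move=> [df Cf]; split=> [x Ux|v]; first by have [] := diff_coord j (df x Ux).
apply: (Ck_eq oU _ (IH _ (Cf v))) => x Ux.
by have [_ ->] := diff_coord j (df x Ux).
Qed.

Lemma Ck_comp k m n (U : set 'rV[R]_m) (W : set 'rV[R]_n)
    (f : 'rV[R]_m -> 'rV[R]_n) (g : 'rV[R]_n -> R^o) :
  open U -> (forall x, U x -> W (f x)) ->
  Ck k U f -> Ck k W g -> Ck k U (g \o f).
Proof.
move=> oU UW; elim: k g => [|k IH] g.
  by move=> cf cg x Ux; apply: continuous_comp; [exact: cf|exact: cg (UW _ Ux)].
move=> Cf1 [dg Cg]; have [df Cf] := Cf1; split=> [x Ux|v].
  by apply: differentiable_comp; [exact: df|exact: dg (UW _ Ux)].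
have S : Ck k U (fun x => \sum_(i < n) 'd f x v 0 i * 'd g (f x) (delta_mx 0 i) : R^o).
  apply: Ck_sum => // i; apply: CkM => //; first exact: Ck_coord oU (Cf v).
  exact: (IH (fun y => 'd g y (delta_mx 0 i)) (CkS Cf1) (Cg _)).
apply: (Ck_eq oU _ S) => x Ux.
rewrite (diff_comp (df x Ux) (dg _ (UW _ Ux)))/=.
rewrite [in RHS](row_sum_delta ('d f x v)) linear_sum.
by apply: eq_bigr => i _; rewrite linearZ.
Qed.

Lemma J_entry m n (f : 'rV[R]_m -> 'rV[R]_n) x i j :
  ('J f x) i j = 'd f x (delta_mx 0 i) 0 j.
Proof. by rewrite /jacobian /lin1_mx mxE. Qed.

Lemma mul_J m n (f : 'rV[R]_m -> 'rV[R]_n) x v : v *m 'J f x = 'd f x v.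
Proof. by rewrite /jacobian mul_rV_lin1. Qed.
End Ck.

(* A smooth n-manifold given by a smooth atlas, not assumed maximal: no notion
   below changes when the atlas is replaced by its maximal one.  [cmap a] and
   [cinv a] are total functions; only their restrictions to [cdom a] and to
   [cmap a @` cdom a] matter, where they are inverse homeomorphisms. *)
Record manifold (R : realType) (n : nat) := Manifold {
  mcarrier :> topologicalType;
  m_hausdorff : hausdorff_space mcarrier;
  m_second_countable : @second_countable mcarrier;
  chart : Type;
  cdom : chart -> set mcarrier;
  cmap : chart -> mcarrier -> 'rV[R]_n;
  cinv : chart -> 'rV[R]_n -> mcarrier;
  cdom_open : forall a, open (cdom a);
  cdom_cover : forall p, exists a, cdom a p;
  cimg_open : forall a, open (cmap a @` cdom a);
  cmapK : forall a p, cdom a p -> cinv a (cmap a p) = p;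
  cmap_continuous : forall a p, cdom a p -> {for p, continuous (cmap a)};
  cinv_continuous : forall a x, (cmap a @` cdom a) x ->
    {for x, continuous (cinv a)};
  chart_compat : forall a b,
    Cinfty (cmap a @` (cdom a `&` cdom b)) (cmap b \o cinv a) }.

Arguments chart {R n} S : rename.
Arguments cdom {R n S} a : rename.
Arguments cmap {R n S} a p : rename.
Arguments cinv {R n S} a x : rename.

Section Manifold.
Context {R : realType} {n : nat} (S : manifold R n).
Implicit Types (a b c : chart S) (p : S) (A : set S).

(* Smoothness of the restriction of f to the open subset A of S. *)
Definition smooth_on A (f : S -> R) : Prop :=
  forall a, Cinfty (cmap a @` (cdom a `&` A)) (f \o cinv a : _ -> R^o).

Definition smooth (f : S -> R) : Prop := smooth_on setT f.

(* Row-vector convention: v *m jac a b p is the image of v under the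
   differential at p of the change of coordinates from chart a to chart b. *)
Definition jac a b p : 'M[R]_n := 'J (cmap b \o cinv a) (cmap a p).

Definition chart_at p : chart S := projT1 (cid (cdom_cover p)).

Lemma chart_atP p : cdom (chart_at p) p.
Proof. exact: projT2 (cid (cdom_cover p)). Qed.

Lemma open_cimg a A : open A -> open (cmap a @` (cdom a `&` A)).
Proof.
move=> oA; rewrite openE => _ [p [ap Ap] <-].
have xI : (cmap a @` cdom a) (cmap a p) by exists p.
have n1 : nbhs (cmap a p) (cmap a @` cdom a).
  by apply: open_nbhs_nbhs; split => //; exact: cimg_open.
have n2 : nbhs (cmap a p) (cinv a @^-1` A).
  apply: (cinv_continuous xI).
  by apply: open_nbhs_nbhs; split => //; rewrite cmapK.
apply: filterS (filterI n1 n2) => y [[q aq <-]].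
by rewrite /= cmapK// => Aq; exists q.
Qed.

Lemma near_cimg a A p (P : 'rV[R]_n -> Prop) : open A -> cdom a p -> A p ->
  (forall q, cdom a q -> A q -> P (cmap a q)) -> \forall y \near cmap a p, P y.
Proof.
move=> oA ap Ap aP.
have : nbhs (cmap a p) (cmap a @` (cdom a `&` A)).
  by apply: open_nbhs_nbhs; split; [exact: open_cimg|exists p].
by apply: filterS => _ [q [aq Aq] <-]; exact: aP.
Qed.

Lemma trans_differentiable a b p : cdom a p -> cdom b p ->
  differentiable (cmap b \o cinv a) (cmap a p).
Proof. by move=> ap bp; apply: (chart_compat a b 1).1; exists p. Qed.

Lemma mul_jac a b p v :
  v *m jac a b p = 'd (cmap b \o cinv a) (cmap a p) v.
Proof. exact: mul_J. Qed.

Lemma jac_id a p : cdom a p -> jac a a p = 1%:M.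
Proof.
move=> ap; apply/row_matrixP => i; rewrite !rowE mulmx1 mul_jac.
have [_ ->] : differentiable (cmap a \o cinv a) (cmap a p) /\
  'd (cmap a \o cinv a) (cmap a p) = 'd id (cmap a p) :> ('rV[R]_n -> 'rV[R]_n).
  apply: near_diff; last exact: ex_diff.
  by apply: (near_cimg openT ap) => // q aq _; rewrite /= cmapK.
by rewrite diff_val.
Qed.

Lemma jac_comp a b c p : cdom a p -> cdom b p -> cdom c p ->
  jac a b p *m jac b c p = jac a c p.
Proof.
move=> ap bp cp; apply/row_matrixP => i.
rewrite 2!rowE mulmxA [X in X *m _]mul_jac [LHS]mul_jac [RHS]mul_jac.
apply: esym.
apply: (@diff_chain _ _ _ _ (cmap b \o cinv a) (cmap c \o cinv b) (cmap c \o cinv a)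
  (cmap a p) (cmap b p) _ (trans_differentiable ap bp)).
- by rewrite /= cmapK.
- exact: trans_differentiable.
- by apply: (near_cimg (cdom_open b) ap) => // q aq bq; rewrite /= !cmapK.
Qed.

(* A tangent vector at p is a family of coordinate vectors, one for each chart
   around p, transforming by the differentials of the coordinate changes.  The
   irrelevant components, at charts not containing p, are set to 0. *)
Definition tangent_pred p : {pred (chart S -> 'rV[R]_n)} :=
  [pred v : chart S -> 'rV[R]_n |
    `[< (forall a, ~ cdom a p -> v a = 0) /\
        (forall a b, cdom a p -> cdom b p -> v b = v a *m jac a b p) >] ].

Lemma tangent_submod p : submod_closed (tangent_pred p).
Proof.
split; first by apply/asboolP; split => // a b _ _; rewrite mul0mx.
move=> k u v /asboolP[u0 uJ] /asboolP[v0 vJ]; apply/asboolP; split.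
  move=> a ap; change (k *: u a + v a = 0).
  by rewrite u0// v0// scaler0 addr0.
move=> a b ap bp; change (k *: u b + v b = (k *: u a + v a) *m jac a b p).
by rewrite (uJ _ _ ap bp) (vJ _ _ ap bp) mulmxDl scalemxAl.
Qed.

HB.instance Definition _ p :=
  GRing.isSubmodClosed.Build R (chart S -> 'rV[R]_n) (tangent_pred p)
    (tangent_submod p).

Record tangent p := Tangent {
  coords :> chart S -> 'rV[R]_n;
  _ : coords \in tangent_pred p }.

HB.instance Definition _ p := [isSub for @coords p].
HB.instance Definition _ p := [Choice of tangent p by <:].
HB.instance Definition _ p := [SubChoice_isSubLmodule of tangent p by <:].

Lemma tangentP p (v : tangent p) :
  (forall a, ~ cdom a p -> v a = 0) /\
  (forall a b, cdom a p -> cdom b p -> v b = v a *m jac a b p).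
Proof. by case: v => v /= /asboolP. Qed.

Lemma tangent_of_coords_subproof a p (w : 'rV[R]_n) :
  (fun b => if `[< cdom a p /\ cdom b p >] then w *m jac a b p else 0)
    \in tangent_pred p.
Proof.
apply/asboolP; split => [b bp|b c bp cp].
  by case: asboolP => // -[].
case: asboolP => [[ap _]|H1]; case: asboolP => [[ap' _]|H2].
- by rewrite -mulmxA jac_comp.
- by case: H2.
- by case: H1.
- by rewrite mul0mx.
Qed.

Definition tangent_of_coords a p (w : 'rV[R]_n) : tangent p :=
  Tangent (tangent_of_coords_subproof a p w).

Lemma coords_linear a p : linear (fun v : tangent p => v a).
Proof. by []. Qed.

Lemma coordsK a p : cdom a p ->
  cancel (fun v : tangent p => v a) (@tangent_of_coords a p).
Proof.
move=> ap v; apply: val_inj; apply/funext => b /=; have [v0 vJ] := tangentP v.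
case: asboolP => [[_ bp]|H]; first by rewrite -vJ.
by rewrite v0// => bp; apply: H.
Qed.

Lemma tangent_of_coordsK a p : cdom a p ->
  cancel (@tangent_of_coords a p) (fun v : tangent p => v a).
Proof.
by move=> ap w /=; case: asboolP => [_|[]//]; rewrite jac_id// mulmx1.
Qed.

(* The derivative v(f) of a function in the direction of a tangent vector; by
   [tderivE] any chart around p may be used. *)
Definition tderiv p (v : tangent p) (f : S -> R) : R :=
  'd (f \o cinv (chart_at p) : _ -> R^o) (cmap (chart_at p) p) (v (chart_at p)).

Lemma tderivE a p (v : tangent p) (f : S -> R) : cdom a p -> smooth f ->
  tderiv v f = 'd (f \o cinv a : _ -> R^o) (cmap a p) (v a).
Proof.
move=> ap sf; rewrite /tderiv; set b := chart_at p; have bp := chart_atP p.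
apply: esym; have [_ /(_ a b ap bp) ->] := tangentP v.
rewrite mul_jac.
apply: (@diff_chain _ _ _ R^o (cmap b \o cinv a) (f \o cinv b) (f \o cinv a)
  (cmap a p) (cmap b p) _ (trans_differentiable ap bp)).
- by rewrite /= cmapK.
- by apply: (sf b 1).1; exists p.
- by apply: (near_cimg (cdom_open b) ap) => // q aq bq; rewrite /= !cmapK.
Qed.

Lemma jac_smooth a b i j : smooth_on (cdom a `&` cdom b)
  (fun p => tangent_of_coords a p (delta_mx 0 i) b 0 j).
Proof.
move=> c k.
have oU := @open_cimg c _ (openI (cdom_open a) (cdom_open b)).
set U := cmap c @` _ in oU *.
set W := cmap a @` (cdom a `&` cdom b).
have oW : open W by exact: open_cimg (cdom_open b).
pose g (x : 'rV[R]_n) : R^o := 'd (cmap b \o cinv a) x (delta_mx 0 i) 0 j.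
have Cg : Ck k W g by apply: (Ck_coord j oW); exact: (chart_compat a b k.+1).2.
have Cf : Ck k U (cmap a \o cinv c).
  by apply: Ck_sub (chart_compat c a k) => _ [p [cp [ap bp]] <-]; exists p.
have UW x : U x -> W ((cmap a \o cinv c) x).
  by move=> [p [cp [ap bp]] <-]; rewrite /= cmapK//; exists p.
apply: (Ck_eq oU _ (Ck_comp oU UW Cf Cg)) => _ [p [cp [ap bp]] <-].
rewrite /= cmapK//; case: asboolP => [_|[]//].
by rewrite mul_J.
Qed.

End Manifold.

(* A smooth real vector bundle of rank k, presented by its fibres and local
   trivializations (total over S, meaningful over [tdom i]) with smooth
   transition functions; these data determine the topology and the smooth
   structure of the total space.  The local frame over [tdom i] is the image of
   the standard basis under [trivV i], and smoothness of sections, fibre metrics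
   and bundle morphisms is smoothness of their components in local frames. *)
Record vbundle (R : realType) (n : nat) (S : manifold R n) (k : nat) :=
  VBundle {
  fib :> S -> lmodType R;
  tridx : Type;
  tdom : tridx -> set S;
  triv : tridx -> forall p, fib p -> 'rV[R]_k;
  trivV : tridx -> forall p, 'rV[R]_k -> fib p;
  tdom_open : forall i, open (tdom i);
  tdom_cover : forall p, exists i, tdom i p;
  triv_linear : forall i p, tdom i p -> linear (@triv i p);
  trivK : forall i p, tdom i p -> cancel (@triv i p) (trivV i p);
  trivVK : forall i p, tdom i p -> cancel (trivV i p) (@triv i p);
  trans_smooth : forall i j a b, smooth_on (tdom i `&` tdom j)
    (fun p => triv j (trivV i p (delta_mx 0 a)) 0 b) }.

Arguments fib {R n S k} E p : rename.
Arguments tridx {R n S k} E : rename.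
Arguments tdom {R n S k E} i : rename.
Arguments triv {R n S k E} i {p} v : rename.
Arguments trivV {R n S k E} i p w : rename.

Definition tangent_bundle (R : realType) (n : nat) (S : manifold R n) :
    vbundle S n :=
  @VBundle R n S n (fun p => tangent p : lmodType R) (chart S) cdom
    (fun a p (v : tangent p) => v a) (@tangent_of_coords R n S)
    (@cdom_open R n S) (@cdom_cover R n S)
    (fun a p _ => @coords_linear R n S a p) (@coordsK R n S)
    (@tangent_of_coordsK R n S) (@jac_smooth R n S).

Section Bundles.
Context {R : realType} {n : nat} {S : manifold R n}.

Definition sect k (E : vbundle S k) := forall p : S, E p.

Definition frame k (E : vbundle S k) (i : tridx E) (a : 'I_k) : sect E :=
  fun p => trivV i p (delta_mx 0 a).

Definition smooth_sect k (E : vbundle S k) (s : sect E) : Prop :=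
  forall (i : tridx E) (a : 'I_k), smooth_on (tdom i) (fun p => triv i (s p) 0 a).

Record fibre_metric k (E : vbundle S k) := FibreMetric {
  fmetric :> forall p, E p -> E p -> R;
  fmetric_linear : forall p u, scalar (@fmetric p u);
  fmetric_sym : forall p u v, @fmetric p u v = fmetric v u;
  fmetric_gt0 : forall p v, v != 0 -> 0 < @fmetric p v v;
  fmetric_smooth : forall (i : tridx E) a b,
    smooth_on (tdom i) (fun p => fmetric (frame i a p) (frame i b p)) }.

(* Smooth vector bundle morphisms over the identity of S. *)
Record bundle_hom k l (E : vbundle S k) (F : vbundle S l) := BundleHom {
  bhom :> forall p, E p -> F p;
  bhom_linear : forall p, linear (@bhom p);
  bhom_smooth : forall (i : tridx E) (j : tridx F) a b,
    smooth_on (tdom i `&` tdom j) (fun p => triv j (bhom (frame i a p)) 0 b) }.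

Definition vfield := sect (tangent_bundle S).

Definition lie (X : vfield) (f : S -> R) : S -> R := fun p => tderiv (X p) f.

(* A connection acts on smooth vector fields and smooth sections.  For
   convenience [nabla] is defined on arbitrary sections; nothing is required of
   its values outside the smooth ones. *)
Record connection k (E : vbundle S k) := Connection {
  nabla :> vfield -> sect E -> sect E;
  nabla_smooth : forall (X : vfield) (s : sect E),
    smooth_sect X -> smooth_sect s -> smooth_sect (nabla X s);
  nablaDl : forall (X Y : vfield) (s : sect E),
    smooth_sect X -> smooth_sect Y -> smooth_sect s ->
    forall p, nabla (fun q => X q + Y q) s p = nabla X s p + nabla Y s p;
  nablaZl : forall (f : S -> R) (X : vfield) (s : sect E),
    smooth f -> smooth_sect X -> smooth_sect s ->
    forall p, nabla (fun q => f q *: X q) s p = f p *: nabla X s p;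
  nablaDr : forall (X : vfield) (s t : sect E),
    smooth_sect X -> smooth_sect s -> smooth_sect t ->
    forall p, nabla X (fun q => s q + t q) p = nabla X s p + nabla X t p;
  nabla_leibniz : forall (f : S -> R) (X : vfield) (s : sect E),
    smooth f -> smooth_sect X -> smooth_sect s ->
    forall p, nabla X (fun q => f q *: s q) p =
      lie X f p *: s p + f p *: nabla X s p }.

Definition bilinear_form k (E : vbundle S k) := forall p : S, E p -> E p -> R.

(* (D_X h)(s, t) = X(h(s, t)) - h(D_X s, t) - h(s, D_X t). *)
Definition cov_form k (E : vbundle S k) (D : connection E) (X : vfield)
    (h : bilinear_form E) (s t : sect E) : S -> R := fun p =>
  lie X (fun q => h q (s q) (t q)) p
    - h p (D X s p) (t p) - h p (s p) (D X t p).

(* The connection induced on Hom(E, F):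
   (D_X Rm)(s) = DF_X (Rm s) - Rm (DE_X s). *)
Definition cov_hom k l (E : vbundle S k) (F : vbundle S l) (DE : connection E)
    (DF : connection F) (X : vfield) (Rm : bundle_hom E F) (s : sect E) :
    sect F := fun p =>
  DF X (fun q => Rm q (s q)) p - Rm p (DE X s p).

Definition metric_connection k (E : vbundle S k) (h : fibre_metric E)
    (D : connection E) : Prop :=
  forall (X : vfield) (s t : sect E),
    smooth_sect X -> smooth_sect s -> smooth_sect t ->
    forall p, cov_form D X h s t p = 0.

(* W = [X, Y], the bracket being the commutator of derivations. *)
Definition is_lie_bracket (X Y W : vfield) : Prop :=
  forall f : S -> R, smooth f ->
  forall p, lie W f p = lie X (lie Y f) p - lie Y (lie X f) p.

Definition torsion_free (D : connection (tangent_bundle S)) : Prop :=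
  forall X Y : vfield, smooth_sect X -> smooth_sect Y ->
  is_lie_bracket X Y (fun p => D X Y p - D Y X p).

Definition levi_civita (g : fibre_metric (tangent_bundle S))
    (D : connection (tangent_bundle S)) : Prop :=
  metric_connection g D /\ torsion_free D.

(* Rm^* h; for Rm : TS -> Z this is the response metric, which is only positive
   semidefinite unless Rm is injective. *)
Definition pullback_form k l (E : vbundle S k) (F : vbundle S l)
    (Rm : bundle_hom E F) (h : fibre_metric F) : bilinear_form E :=
  fun p u v => h p (Rm p u) (Rm p v).

End Bundles.

Arguments vfield {R n} S.

(* Main.v *)
(* Metric compatibility of the connection on Z, applied to the sections RY and
   RW, rewrites X(h(RY, RW)); the rest is bilinearity of h.  Compatibility is given
   only for smooth sections, so the analytic content is that a bundle morphism
   maps smooth sections to smooth sections. *)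
From HB Require Import structures.
Require Import Defs.
From mathcomp Require Import all_boot all_order all_algebra.
From mathcomp Require Import all_classical all_reals all_analysis.
From mathcomp Require Import ring.
Import GRing.Theory.
Local Open Scope classical_set_scope.
Local Open Scope ring_scope.

(** [Ck] imposes conditions on the total function [f] and its differentials point by point, so each
    point may use its own [U']; the same [U'] serves again for ['d f x v] in the induction. *)
Lemma Ck_local (R : realType) (m : nat) (V W : normedModType R) (U : set V)
    (f : V -> W) :
  (forall x, U x -> exists2 U', U' x & Ck m U' f) -> Ck m U f.
Proof.
elim: m f => [|m IH] f Uf /=.
  by move=> x /Uf[U' U'x]; apply.
split=> [x /Uf[U' U'x [df _]]|v]; first exact: df.
by apply: IH => x /Uf[U' U'x [_ Cf]]; exists U' => //; exact: Cf.
Qed.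

Lemma smooth_on_local (R : realType) (n : nat) (S : manifold R n) (A : set S)
    (f : S -> R) :
  (forall p, A p -> exists2 B : set S, B p & smooth_on (A `&` B) f) ->
  smooth_on A f.
Proof.
move=> Af c m; apply: Ck_local => _ [p [cp Ap] <-].
have [B Bp sf] := Af p Ap.
by exists (cmap c @` (cdom c `&` (A `&` B))); [exists p | exact: sf].
Qed.

Section BundleHom.
Context {R : realType} {n k l : nat} {S : manifold R n}.
Context {E : vbundle S k} {F : vbundle S l} (Rm : bundle_hom E F).
Implicit Types p : S.

(** The matrix of [Rm] in local frames: read through the trivializations, [Rm p] is a linear map of
    row vectors, determined by its values on the standard basis. *)
Lemma triv_bhom_frame (i : tridx E) (j : tridx F) p (u : E p) (b : 'I_l) :
  tdom i p -> tdom j p ->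
  triv j (Rm p u) 0 b =
  \sum_(a < k) triv i u 0 a * triv j (Rm p (frame i a p)) 0 b.
Proof.
move=> ip jp.
have lin : linear (fun w => triv j (Rm p (trivV i p w)) 0 b : R^o).
  have trivV_lin (a : R) w1 w2 :
      trivV i p (a *: w1 + w2) = a *: trivV i p w1 + trivV i p w2.
    (* The inverse of a linear bijection is linear: compare both sides after applying [triv i]. *)
    apply: (can_inj (trivK ip)).
    by rewrite (triv_linear ip) !(trivVK ip).
  by move=> a w1 w2; rewrite trivV_lin bhom_linear (triv_linear jp) !mxE.
pose phi : {linear 'rV[R]_k -> R^o} := HB.pack
  (fun w => triv j (Rm p (trivV i p w)) 0 b : R^o)
  (GRing.isLinear.Build _ _ _ _ _ lin).
rewrite -[in LHS](trivK ip u) -[LHS]/(phi (triv i u)).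
rewrite [in LHS](row_sum_delta (triv i u)) linear_sum.
by apply: eq_bigr => a _; rewrite linearZ.
Qed.

(** Over [tdom i] and [tdom j] together, each component of the image is a finite sum of products of
    components of [s] with matrix entries of [Rm], all smooth. *)
Lemma smooth_bhom (s : sect E) :
  smooth_sect s -> smooth_sect (fun q => Rm q (s q)).
Proof.
move=> ss j b; apply: smooth_on_local => p jp.
(* A frame of [E] exists only locally, so the domain is shrunk around [p]. *)
have [i ip] := tdom_cover E p.
exists (tdom i) => // c m.
have oU := @open_cimg _ _ _ c _ (openI (tdom_open j) (tdom_open i)).
pose t a (x : 'rV[R]_n) : R^o := triv i (s (cinv c x)) 0 a *
  triv j (Rm (cinv c x) (frame i a (cinv c x))) 0 b.
apply: (@Ck_eq _ _ _ _ _ (fun x => \sum_(a < k) t a x)) => //.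
  by move=> _ [q [cq [jq iq]] <-]; rewrite /t /= cmapK//= -triv_bhom_frame.
apply: Ck_sum => // a; apply: CkM => //.
  by apply: Ck_sub (ss i a c m) => _ [q [cq [jq iq]] <-]; exists q.
apply: Ck_sub (bhom_smooth Rm i j a b c m) => _ [q [cq [jq iq]] <-].
by exists q.
Qed.

End BundleHom.

Section FibreMetric.
Context {R : realType} {n k : nat} {S : manifold R n} {E : vbundle S k}.
Variable h : fibre_metric E.

Lemma fmetricBr (p : S) (u v w : E p) : h p u (v - w) = h p u v - h p u w.
Proof.
(* The difference is read as [-1 *: w + v]. *)
have := fmetric_linear h u (-1) w v.
by rewrite scaleN1r mulN1r [- w + v]addrC [- _ + _]addrC.
Qed.

Lemma fmetricBl (p : S) (u v w : E p) : h p (u - v) w = h p u w - h p v w.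
Proof. by rewrite !(fmetric_sym h _ w) fmetricBr. Qed.

End FibreMetric.

Theorem proposition6p2 (R : realType) (n k : nat) (S : manifold R n)
    (Z : vbundle S k) (hZ : fibre_metric Z)
    (Rm : bundle_hom (tangent_bundle S) Z)
    (gS : fibre_metric (tangent_bundle S))
    (nablaS : connection (tangent_bundle S)) (nablaZ : connection Z)
    (hLC : levi_civita gS nablaS) (hmet : metric_connection hZ nablaZ)
    (X Y W : vfield S)
    (hX : smooth_sect X) (hY : smooth_sect Y) (hW : smooth_sect W) (p : S) :
  cov_form nablaS X (pullback_form Rm hZ) Y W p =
    hZ p (cov_hom nablaS nablaZ X Rm Y p) (Rm p (W p)) +
    hZ p (Rm p (Y p)) (cov_hom nablaS nablaZ X Rm W p).
Proof.
have := hmet X _ _ hX (smooth_bhom Rm Y hY) (smooth_bhom Rm W hW) p.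
rewrite /cov_form /cov_hom /pullback_form fmetricBl fmetricBr.
(* Solve compatibility for the derivative of [hZ(RY, RW)] along [X]; after substitution the [nablaS]
   terms match. *)
move=> /eqP; rewrite -addrA -opprD subr_eq0 => /eqP ->.
by ring.
Qed.
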